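(* Let $\mu_1>\mu_2$ be real numbers, $\sigma>0$, $p,q\in[0,1]$, and let $\tilde n_+,\tilde n_-$ be positive integers. Let $I^+_1,\dots,I^+_{\tilde n_+}$ be i.i.d. $\mathrm{Bernoulli}(p)$ and $I^-_1,\dots,I^-_{\tilde n_-}$ be i.i.d. $\mathrm{Bernoulli}(q)$. Let $\tilde X^+_1,\dots,\tilde X^+_{\tilde n_+}$ and $\tilde X^-_1,\dots,\tilde X^-_{\tilde n_-}$ be real random variables such that the pairs $(I^+_i,\tilde X^+_i)$, $i=1,\dots,\tilde n_+$, and $(I^-_j,\tilde X^-_j)$, $j=1,\dots,\tilde n_-$, are all mutually independent, and: conditional on $I^+_i=1$, $\tilde X^+_i\sim\mathcal N(\mu_1,\sigma^2)$, and conditional on $I^+_i=0$, $\tilde X^+_i\sim\mathcal N(\mu_2,\sigma^2)$; conditional on $I^-_j=1$, $\tilde X^-_j\sim\mathcal N(\mu_2,\sigma^2)$, and conditional on $I^-_j=0$, $\tilde X^-_j\sim\mathcal N(\mu_1,\sigma^2)$. Let $\Delta=p-q$ and $$\hat\theta=\frac12\Big(\frac{1}{\tilde n_+}\sum_{i=1}^{\tilde n_+}\tilde X^+_i+\frac{1}{\tilde n_-}\sum_{j=1}^{\tilde n_-}\tilde X^-_j\Big).$$ Then for every $\delta>0$, with probability at least $$1-2\exp\Big(-\frac{2\delta^2}{9\sigma^2}\cdot\frac{\tilde n_+\tilde n_-}{\tilde n_-+\tilde n_+}\Big)-2\exp\Big(-\frac{8\tilde n_+\delta^2}{9(\mu_1-\mu_2)^2}\Big)-2\exp\Big(-\frac{8\tilde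 n_-\delta^2}{9(\mu_1-\mu_2)^2}\Big),$$ we have $$\Big|\hat\theta-\frac{\mu_1+\mu_2}{2}-\frac{\Delta(\mu_1-\mu_2)}{2}\Big|\le\delta.$$
   Context: This models pseudo-labeling of unlabeled data for a binary problem where $X\mid Y=+1\sim\mathcal N(\mu_1,\sigma^2)$ and $X\mid Y=-1\sim\mathcal N(\mu_2,\sigma^2)$ (so the Bayes classifier thresholds at $(\mu_1+\mu_2)/2$). The $\tilde X^+_i$ are the unlabeled points assigned pseudo-label $+1$ by a base classifier that is correct on each with probability $p$ (indicator $I^+_i$), and the $\tilde X^-_j$ are those assigned pseudo-label $-1$, correct with probability $q$ (indicator $I^-_j$). *)

(* Defs.v *)
From HB Require Import structures.
From mathcomp Require Import all_boot all_order all_algebra.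
From mathcomp Require Import all_classical all_reals all_analysis.
Set Implicit Arguments. Unset Strict Implicit. Unset Printing Implicit Defensive.
Import Order.TTheory GRing.Theory Num.Theory.
Import numFieldNormedType.Exports.
Local Open Scope classical_set_scope.
Local Open Scope ring_scope.

Definition mutually_independent {d dU : measure_display} {T : measurableType d}
  {R : realType} {U : measurableType dU} (P : probability T R) {K : finType}
  (Z : K -> T -> U) : Prop :=
  forall (J : {set K}) (B : K -> set U),
    (forall k, k \in J -> measurable (B k)) ->
    P (\bigcap_(k in [set k | k \in J]) (Z k @^-1` B k)) =
    (\big[*%E/1%E]_(k in J) P (Z k @^-1` B k))%E.

Definition pair_rv {T : Type} {R : realType} (I : T -> bool) (X : T -> R)
  : T -> (bool * R)%type := fun t => (I t, X t).

Definition all_pairs {T : Type} {R : realType} {np nm : nat}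
  (Ip : 'I_np -> T -> bool) (Xp : 'I_np -> T -> R)
  (Im : 'I_nm -> T -> bool) (Xm : 'I_nm -> T -> R)
  : ('I_np + 'I_nm)%type -> T -> (bool * R)%type :=
  fun k => match k with
           | inl i => pair_rv (Ip i) (Xp i)
           | inr j => pair_rv (Im j) (Xm j)
           end.

(* Main.v *)
Require Import Defs.
From HB Require Import structures.
From mathcomp Require Import all_boot all_order all_algebra.
From mathcomp Require Import all_classical all_reals all_analysis measurable_realfun.
From mathcomp Require Import ring lra.
Import Order.TTheory GRing.Theory Num.Theory.
Import numFieldNormedType.Exports.
Local Open Scope classical_set_scope.
Local Open Scope ring_scope.

(** Write each observation as its conditional mean given the indicator plus a
    centered Gaussian noise. Then the deviation of [theta_hat] is the sum of
    three independent-sum terms: the averaged noise, the fluctuation of the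
    positive indicators around [p] and that of the negative ones around [q],
    both scaled by [(mu1 - mu2) / 2]. All summands are sub-Gaussian (by the
    Gaussian moment generating function and by Hoeffding's lemma for Bernoulli
    variables), so the Chernoff bound controls the probability that any of the
    three terms reaches [delta / 3]. *)

(** * Hoeffding's lemma for Bernoulli variables *)

(** The condition [0 <= s * c] places [c] on the same side of 0 as [s]. Both signs of [s] are thus
    handled at once, and the lemma can be applied again at [c] to reach the second derivative. *)
Lemma MVT_from0 (R : realType) (f df : R -> R) :
  (forall x : R, is_derive x 1 f (df x)) -> f 0 = 0 ->
  forall s, exists2 c, 0 <= s * c & f s = df c * s.
Proof.
move=> fd f0 s.
have cf a b : {within `[a, b], continuous f}.
  apply: derivable_within_continuous => x _; exact: ex_derive.
have [s0|s0] := leP 0 s.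
- have [c + E] := MVT_segment s0 (fun x _ => fd x) (cf _ _).
  rewrite in_itv/= => /andP[c0 _].
  by exists c; [rewrite mulr_ge0|move: E; rewrite f0 !subr0].
- have [c + E] := MVT_segment (ltW s0) (fun x _ => fd x) (cf _ _).
  rewrite in_itv/= => /andP[_ c0].
  exists c; first by rewrite nmulr_rge0.
  by move: E; rewrite f0 !sub0r mulrN => /oppr_inj.
Qed.

(* With [u x = p e^x / (1 - p + p e^x)], the second derivative of
   [p x + x^2/8 - ln (1 - p + p e^x)] is [1/4 - u (1 - u) >= 0]. *)
Lemma bernoulli_hoeffding (R : realType) (p s : R) : 0 <= p <= 1 ->
  p * expR (s * (1 - p)) + (1 - p) * expR (- (s * p)) <= expR (s ^+ 2 / 8).
Proof.
move=> /andP[p0 p1].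
pose D x := 1 - p + p * expR x.
have Dgt0 x : 0 < D x.
  have := expR_gt0 x; rewrite /D => e0.
  have [->|pn0] := eqVneq p 0; first by rewrite mul0r subr0 addr0.
  by rewrite ltr_wpDl ?subr_ge0// mulr_gt0// lt_neqAle eq_sym pn0.
have dD (x : R) : is_derive x 1 D (p * expR x).
  rewrite (_ : D = cst (1 - p) + p \*: expR)//.
  by apply: is_derive_eq; rewrite add0r.
pose u x := 1 - (1 - p) / D x.
have du (x : R) : is_derive x 1 u (u x * (1 - u x)).
  have dV := is_deriveV (lt0r_neq0 (Dgt0 x)) (dD x).
  have -> : u x * (1 - u x) = 0 - (1 - p) * (- D x ^- 2 * (p * expR x)).
    by have := lt0r_neq0 (Dgt0 x); rewrite /u /D => ?; field.
  have -> : u = cst 1 - (1 - p) \*: (fun y => (D y)^-1) by [].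
  exact: is_deriveB.
pose phi x := p * x + x ^+ 2 / 8 - ln (D x).
pose dphi x := p + x / 4 - u x.
have dphiP (x : R) : is_derive x 1 phi (dphi x).
  have dl : is_derive x 1 (@ln R \o D) ((D x)^-1 * (p * expR x)).
    by apply: is_derive1_comp; exact: is_derive1_ln.
  have -> : phi = (p \*: id + 8^-1 \*: (id ^+ 2)) - (@ln R \o D).
    by apply/funext => y /=; rewrite /phi !fctE /GRing.scale/= /GRing.scale/= [_ / 8]mulrC.
  apply: is_derive_eq; rewrite /GRing.scale/= /dphi /u.
  have := lt0r_neq0 (Dgt0 x); rewrite /D => D0.
  by field.
have ddphi (x : R) : is_derive x 1 dphi (4^-1 - u x * (1 - u x)).
  have -> : dphi = cst p + 4^-1 \*: id - u.
    by apply/funext => y /=; rewrite /dphi !fctE /GRing.scale/= [_ / 4]mulrC.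
  by apply: is_derive_eq; rewrite /GRing.scale/= add0r mulr1.
have D0 : D 0 = 1 by rewrite /D expR0; ring.
have dphi0 : dphi 0 = 0 by rewrite /dphi /u D0; field.
have phi0 : phi 0 = 0 by rewrite /phi D0 ln1; ring.
(* Two mean value steps give [phi s] as [phi''(e) * c * s], where [c * s] is nonnegative and
   [phi''(e)] equals [(u e - 1/2) ^+ 2]. *)
have phi_ge0 : 0 <= phi s.
  have [c sc ->] := MVT_from0 _ _ _ dphiP phi0 s.
  have [e _ ->] := MVT_from0 _ _ _ ddphi dphi0 c.
  rewrite -mulrA [c * s]mulrC mulr_ge0//.
  by have := sqr_ge0 (u e - 2^-1); lra.
(* Factoring out [expR (- (p * s))] leaves [D s], so the claim becomes [0 <= phi s]. *)
have -> : p * expR (s * (1 - p)) + (1 - p) * expR (- (s * p)) =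
    expR (ln (D s) - p * s).
  rewrite expRD lnK ?posrE// /D [RHS]mulrDl addrC -[X in _ = _ + X]mulrA -expRD.
  by congr (_ * expR _ + _ * expR _); ring.
by rewrite ler_expR; move: phi_ge0; rewrite /phi; lra.
Qed.

(** * Change of variables with a weight *)

Section transfer.
Import HBNNSimple.

(** The hypothesis is the claim for indicators; linearity extends it to simple functions and
    monotone convergence to nonnegative ones. The weight [g] will be a density, the indicator of a
    conditioning event, or the product of the other independent factors. *)
Lemma ge0_integral_transfer (R : realType) (d d' : measure_display)
    (T : measurableType d) (U : measurableType d')
    (mu : {measure set T -> \bar R}) (nu : {measure set U -> \bar R})
    (Z : T -> U) (g : T -> R) :
  measurable_fun setT Z -> measurable_fun setT g -> (forall t, 0 <= g t) ->
  (forall B, measurable B -> \int[mu]_t (\1_B (Z t) * g t)%:E = nu B)%E ->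
  forall f : U -> R, measurable_fun setT f -> (forall u, 0 <= f u) ->
  (\int[mu]_t (f (Z t) * g t)%:E = \int[nu]_u (f u)%:E)%E.
Proof.
move=> mZ mg g0 indic_eq f mf f0.
have /measurable_EFinP mfE := mf.
pose f_ := nnsfun_approx measurableT mfE.
have f0E u : [set: U] u -> (0 <= (f u)%:E)%E by rewrite lee_fin.
have fcvg u : (f_ n u)%:E @[n --> \oo] --> (f u)%:E.
  exact: (cvg_nnsfun_approx measurableT mfE f0E).
have fnd u : {homo (fun n => f_ n u) : m n / (m <= n)%N >-> m <= n}.
  by move=> m n mn; exact/lefP/nd_nnsfun_approx.
transitivity (limn (fun n => \int[mu]_t (f_ n (Z t) * g t)%:E)%E).
  rewrite -monotone_convergence//.
  - apply: eq_integral => t _; apply/esym/cvg_lim => //.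
    under eq_fun do rewrite EFinM.
    rewrite EFinM; apply: cvgeZr => //; exact: fcvg.
  - move=> n; apply/measurable_EFinP/measurable_funM => //.
    by apply: measurableT_comp mZ.
  - by move=> n t _; rewrite lee_fin mulr_ge0.
  - by move=> t _ m n mn; rewrite lee_fin ler_wpM2r// fnd.
transitivity (limn (fun n => \int[nu]_u (f_ n u)%:E)%E); last first.
  rewrite -monotone_convergence//.
  - by apply: eq_integral => u _; apply/cvg_lim => //; exact: fcvg.
  - by move=> n; exact/measurable_EFinP.
  - by move=> n t _; rewrite lee_fin.
  - by move=> t _ m n mn; rewrite lee_fin fnd.
congr (limn _); apply/funext => n.
rewrite integralT_nnsfun sintegralE.
(* The contribution of the value [r] of the simple function. It is nonnegative even for negative
   [r], whose level set is empty. *)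
pose h r t : R := r * \1_(f_ n @^-1` [set r]) (Z t) * g t.
have h0 r t : 0 <= h r t.
  rewrite /h mulr_ge0// indicE.
  by have [/[!inE]/= <-|_] := boolP (_ \in _); rewrite ?mulr1 ?mulr0.
have mind r : measurable_fun setT
    (fun t => \1_(f_ n @^-1` [set r]) (Z t) * g t : R).
  by apply: measurable_funM => //; exact: measurableT_comp mZ.
transitivity (\int[mu]_t (\sum_(r \in range (f_ n)) (h r t)%:E))%E.
  apply: eq_integral => t _.
  by rewrite {1}fimfunE mulr_fsuml// -fsumEFin.
rewrite ge0_integral_fsum//.
- apply: eq_fsbigr => r /[!inE] -[u _ <-].
  rewrite -indic_eq// -ge0_integralZl//.
  + by apply: eq_integral => t _; rewrite -EFinM mulrA.
  + exact/measurable_EFinP.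
  + by move=> t _; rewrite lee_fin mulr_ge0// indicE.
  + by rewrite lee_fin.
- move=> r; apply/measurable_EFinP; rewrite /h.
  under eq_fun do rewrite -mulrA.
  exact: measurable_funM.
- by move=> r t _; rewrite lee_fin.
Qed.

End transfer.

(** * The Gaussian moment generating function *)

Lemma integral_normal_mgf (R : realType) (m sigma t : R) : 0 < sigma ->
  (\int[normal_prob m sigma]_x (expR (t * (x - m)))%:E =
   (expR (t ^+ 2 * sigma ^+ 2 / 2))%:E)%E.
Proof.
move=> s0; have sn0 : sigma != 0 by rewrite gt_eqF.
have mexp : measurable_fun setT (fun x : R => expR (t * (x - m))).
  by apply: measurableT_comp => //; apply: measurable_funM => //;
    exact: measurable_funB.
rewrite -(ge0_integral_transfer _ _ _ _ _ lebesgue_measure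
  (normal_prob m sigma) id (normal_pdf m sigma))//; last first.
- move=> B mB; rewrite /normal_prob [RHS]integral_mkcond.
  apply: eq_integral => x _; rewrite /patch indicE.
  by case: ifPn; rewrite ?mul1r ?mul0r.
- exact: normal_pdf_ge0.
- exact: measurable_normal_pdf.
(* Completing the square: the exponential tilt of the density is a constant times the normal density
   with mean shifted to [m'], which integrates to 1. *)
pose m' := m + sigma ^+ 2 * t.
transitivity (\int[lebesgue_measure]_x
  ((expR (t ^+ 2 * sigma ^+ 2 / 2))%:E * (normal_pdf m' sigma x)%:E))%E.
  apply: eq_integral => x _; rewrite -EFinM; congr EFin.
  rewrite !normal_pdfE// mulrCA [RHS]mulrCA; congr (_ * _).
  rewrite /normal_fun -!expRD; congr expR.
  by rewrite /m' -mulr_natr; field.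
rewrite ge0_integralZl//.
- by rewrite integral_normal_pdf mule1.
- by apply/measurable_EFinP; exact: measurable_normal_pdf.
- by move=> x _; rewrite lee_fin normal_pdf_ge0.
Qed.

(** * Expectation of a product of independent factors *)

Lemma expectation_prod_independent (R : realType) (d dU : measure_display)
    (T : measurableType d) (U : measurableType dU) (P : probability T R)
    (K : finType) (Z : K -> T -> U) (h : K -> U -> R) :
  (forall k, measurable_fun setT (Z k)) -> mutually_independent P Z ->
  (forall k, measurable_fun setT (h k)) -> (forall k u, 0 <= h k u) ->
  (forall k, \int[P]_t (h k (Z k t))%:E < +oo)%E ->
  (\int[P]_t (\prod_k h k (Z k t))%:E =
   \big[*%E/1%E]_k \int[P]_t (h k (Z k t))%:E)%E.
Proof.
move=> mZ indep.
(* Replace the indicators of the definition by general functions one index at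
   a time: [s] lists the indices already replaced. *)
suff H (s : seq K) : forall h : K -> U -> R,
    (forall k, measurable_fun setT (h k)) -> (forall k u, 0 <= h k u) ->
    (forall k, \int[P]_t (h k (Z k t))%:E < +oo)%E ->
    (forall k, k \notin s -> exists B, measurable B /\ h k = \1_B) ->
    (\int[P]_t (\prod_k h k (Z k t))%:E =
     \big[*%E/1%E]_k \int[P]_t (h k (Z k t))%:E)%E.
  by move=> mh h0 hfin; apply: (H (enum K)) => // k; rewrite mem_enum.
elim: s => [|k0 s IH] {}h mh h0 hfin hind.
  (* Base case: every factor is an indicator, so the product is the indicator of an intersection,
     and independence over the full index set applies. *)
  have /choice[B hB] : forall k, exists B, measurable B /\ h k = \1_B.
    by move=> k; exact: hind.
  have mB k : measurable (B k) by have [] := hB k.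
  have mZB k : measurable (Z k @^-1` B k).
    by rewrite -[X in measurable X]setTI; exact: mZ.
  have := indep finset.setT B (fun k _ => mB k).
  set C := \bigcap_(_ in _) _ => PC.
  have mC : measurable C by apply: fin_bigcap_measurable.
  transitivity (\int[P]_t (\1_C t)%:E)%E.
    apply: eq_integral => t _; congr EFin.
    have [Ct|nCt] := pselect (C t).
      rewrite indicE mem_set// big1// => k _; have [_ ->] := hB k.
      by rewrite indicE mem_set//; apply: Ct; rewrite /= inE.
    have /existsNP[k /not_implyP[_ nBk]] := nCt.
    rewrite indicE memNset// (bigD1 k)//=; have [_ ->] := hB k.
    by rewrite indicE memNset// mul0r.
  rewrite integral_indic// setIT; apply: (etrans PC).
  rewrite (eq_bigl xpredT) => [|k]; last by rewrite inE.
  apply: eq_bigr => k _; have [_ ->] := hB k.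
  by rewrite -[in LHS](setIT (_ @^-1` _)) -integral_indic.
(* The transfer lemma is used with weight [g]: under the measure with density [g], the variable
   [Z k0] has [c] times its original law. Finiteness of the integrals makes [c] a real number. *)
pose g t := \prod_(k | k != k0) h k (Z k t).
have g0 t : 0 <= g t by exact: prodr_ge0.
have mg : measurable_fun setT g.
  rewrite /g; under eq_fun do rewrite -big_filter.
  by apply: measurable_prod => k _; exact: measurableT_comp (mh k) (mZ k).
pose c := \prod_(k | k != k0) fine (\int[P]_t (h k (Z k t))%:E)%E.
have E0 k : (0 <= \int[P]_t (h k (Z k t))%:E)%E.
  by apply: integral_ge0 => t _; rewrite lee_fin.
have c0 : 0 <= c by apply: prodr_ge0 => k _; exact: fine_ge0.
have cE : (\big[*%E/1%E]_(k | k != k0) \int[P]_t (h k (Z k t))%:E = c%:E)%E.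
  rewrite /c -prodEFin; apply: eq_bigr => k _.
  by rewrite fineK// ge0_fin_numE.
pose Zk : {mfun T >-> U} :=
  HB.pack (Z k0) (isMeasurableFun.Build _ _ _ _ _ (mZ k0)).
under eq_integral do rewrite (bigD1 k0)//=.
rewrite (bigD1 k0)//= cE.
rewrite (ge0_integral_transfer _ _ _ _ _ P
  (mscale (NngNum c0) (pushforward P Zk)) (Z k0) g)//.
  rewrite ge0_integral_mscale//; last 2 first.
  - exact/measurable_EFinP.
  - by move=> u _; rewrite lee_fin.
  rewrite ge0_integral_pushforward//; last 2 first.
  - exact/measurable_EFinP.
  - by move=> u _; rewrite lee_fin.
  by rewrite muleC preimage_setT.
move=> B mB; rewrite /mscale/= /pushforward.
have mZB : measurable (Z k0 @^-1` B).
  by rewrite -[X in measurable X]setTI; exact: (mZ k0 measurableT B mB).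
have intB : (\int[P]_t (\1_B (Z k0 t))%:E = P (Z k0 @^-1` B))%E.
  by rewrite -[in RHS](setIT (_ @^-1` _)) -integral_indic.
(* The required identity on indicators is the induction hypothesis for the family with the factor at
   [k0] replaced by [\1_B]. *)
pose h' k : U -> R := if k == k0 then \1_B else h k.
have h'0 : h' k0 = \1_B by rewrite /h' eqxx.
have h'N k : k != k0 -> h' k = h k by rewrite /h' => /negbTE ->.
have := IH h'; rewrite (bigD1 k0)//= h'0 intB.
rewrite (eq_bigr (fun k => \int[P]_t (h k (Z k t))%:E)%E); last first.
  by move=> k kk0; rewrite h'N.
rewrite cE muleC => IHB; apply: (etrans _ (IHB _ _ _ _)).
- apply: eq_integral => t _; rewrite (bigD1 k0)//= h'0; congr (_ * _)%:E.
  by apply: eq_bigr => k kk0; rewrite h'N.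
- by move=> k; rewrite /h'; case: ifP.
- by move=> k u; rewrite /h'; case: ifP.
- move=> k; have [->|kk0] := eqVneq k k0; last by rewrite h'N.
  by rewrite h'0 intB (le_lt_trans (probability_le1 _ _))// ltry.
- move=> k ks; have [->|kk0] := eqVneq k k0; first by exists B.
  by rewrite h'N//; apply: hind; rewrite inE negb_or kk0.
Qed.

Lemma measurable_superlevel (R : realType) (d : measure_display)
    (T : measurableType d) (f : T -> R) (a : R) :
  measurable_fun setT f -> measurable [set t | (a <= f t)%R].
Proof.
move=> mf; rewrite -[X in measurable X]setTI.
have -> : [set t | (a <= f t)%R] = f @^-1` `[a, +oo[%classic.
  by apply/seteqP; split => t /=; rewrite in_itv/= andbT.
exact: mf.
Qed.

(** * Sub-Gaussian tails of independent sums *)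

Section subgaussian.
Variables (R : realType) (d dU : measure_display) (T : measurableType d).
Variables (U : measurableType dU) (P : probability T R) (K : finType).
Variable Z : K -> T -> U.
Hypothesis mZ : forall k, measurable_fun setT (Z k).
Hypothesis indepZ : mutually_independent P Z.

(** Chernoff's bound, with the moment generating function of the sum factored by independence.
    Positivity is asked of the total variance proxy only, so that single summands may vanish. *)
Lemma subgaussian_sum_upper_tail (g : K -> U -> R) (v : K -> R) (eps : R) :
  (forall k, measurable_fun setT (g k)) ->
  (forall k s, \int[P]_t (expR (s * g k (Z k t)))%:E <=
               (expR (s ^+ 2 * v k / 2))%:E)%E ->
  0 < \sum_k v k -> 0 < eps ->
  (P [set t | (eps <= \sum_k g k (Z k t))%R] <=
   (expR (- (eps ^+ 2 / (2 * \sum_k v k))))%:E)%E.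
Proof.
move=> mg mgf; set V := \sum_k v k => V0 eps0.
have mgZ k : measurable_fun setT (fun t => g k (Z k t)).
  exact: measurableT_comp (mg k) (mZ k).
pose S t := \sum_k g k (Z k t).
have mS : measurable_fun setT S by exact: measurable_sum.
pose X : {RV P >-> R} := HB.pack S (isMeasurableFun.Build _ _ _ _ _ mS).
(* This is the minimizer of the Chernoff exponent [r ^+ 2 * V / 2 - r * eps]. *)
pose r := eps / V.
have r0 : 0 < r by rewrite divr_gt0.
apply: le_trans (@chernoff _ _ _ P X r eps r0) _.
rewrite /mmt_gen_fun unlock.
have -> : (- (eps ^+ 2 / (2 * V))) = r ^+ 2 * V / 2 - r * eps.
  by rewrite /r; field; rewrite gt_eqF.
rewrite expRD EFinM lee_pmul2r ?lte_fin ?expR_gt0//.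
have -> : (\int[P]_t ((expR \o r \o* X) t)%:E =
    \int[P]_t (\prod_k expR (r * g k (Z k t)))%:E)%E.
  apply: eq_integral => t _; rewrite -expR_sum -mulr_sumr.
  by rewrite /= mulrC.
rewrite (expectation_prod_independent _ _ _ _ _ P _ Z
  (fun k u => expR (r * g k u)))//; last 2 first.
- by move=> k; apply: measurableT_comp => //; exact: measurable_funM.
- by move=> k; rewrite (le_lt_trans (mgf k r))// ltry.
rewrite /V mulr_sumr mulr_suml expR_sum -prodEFin.
(* Multiplying inequalities between extended reals needs nonnegative factors, so the lower bound 0
   is carried through the induction. *)
suff : (0 <= \big[*%E/1%E]_k (\int[P]_t (expR (r * g k (Z k t)))%:E) <=
  \big[*%E/1%E]_k (expR (r ^+ 2 * v k / 2))%:E)%E by case/andP.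
elim/big_ind2 : _ => //.
- by rewrite lee_fin ler01 lexx.
- move=> x1 x2 y1 y2 /andP[x10 x12] /andP[y10 y12].
  by rewrite mule_ge0//= lee_pmul.
- by move=> k _; rewrite mgf andbT; apply: integral_ge0 => t _; rewrite lee_fin.
Qed.

(** A union bound over the upper tails of [g] and of its negation; the latter satisfies the same
    moment bound, with [s] replaced by [- s]. *)
Lemma subgaussian_sum_tail (g : K -> U -> R) (v : K -> R) (eps : R) :
  (forall k, measurable_fun setT (g k)) ->
  (forall k s, \int[P]_t (expR (s * g k (Z k t)))%:E <=
               (expR (s ^+ 2 * v k / 2))%:E)%E ->
  0 < \sum_k v k -> 0 < eps ->
  (P [set t | (eps <= `|\sum_k g k (Z k t)|)%R] <=
   (2 * expR (- (eps ^+ 2 / (2 * \sum_k v k))))%:E)%E.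
Proof.
move=> mg mgf V0 eps0.
have mgZ k : measurable_fun setT (fun t => g k (Z k t)).
  exact: measurableT_comp (mg k) (mZ k).
have mS : measurable_fun setT (fun t => \sum_k g k (Z k t)).
  exact: measurable_sum.
have mN : measurable_fun setT (fun t => \sum_k - g k (Z k t)).
  by apply: measurable_sum => k; exact: measurableT_comp.
have up := subgaussian_sum_upper_tail _ _ _ mg mgf V0 eps0.
have low := subgaussian_sum_upper_tail (fun k u => - g k u) v eps.
rewrite mulr_natl mulr2n EFinD.
apply: le_trans (leeD up (low _ _ V0 eps0)); last 2 first.
- by move=> k; exact: measurableT_comp.
- move=> k s; under eq_integral do rewrite mulrN -mulNr.
  by rewrite -sqrrN mgf.
apply: le_trans (measureU2 _ _ _); last 2 first.
- exact: measurable_superlevel.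
- exact: measurable_superlevel.
apply: le_measure; rewrite ?inE.
- by apply: measurable_superlevel; exact: measurableT_comp mS.
- by apply: measurableU; exact: measurable_superlevel.
- move=> t /=; rewrite sumrN.
  by case: ger0P => _ ?; [left|right].
Qed.

End subgaussian.

(** * Integration against conditional laws *)

(** The conditional law is kept in joint form, which also covers [w = 0], where conditioning on [A]
    would divide by zero. The transfer lemma applies with weight [\1_A]. *)
Lemma ge0_integral_restricted_law (R : realType) (d d' : measure_display)
    (T : measurableType d) (U : measurableType d')
    (mu : {measure set T -> \bar R}) (nu : {measure set U -> \bar R})
    (A : set T) (X : T -> U) (w : R) :
  measurable A -> measurable_fun setT X -> 0 <= w ->
  (forall B, measurable B -> mu (A `&` X @^-1` B) = w%:E * nu B)%E ->
  forall f : U -> R, measurable_fun setT f -> (forall u, 0 <= f u) ->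
  (\int[mu]_t (f (X t) * \1_A t)%:E = w%:E * \int[nu]_u (f u)%:E)%E.
Proof.
move=> mA mX w0 law f mf f0.
rewrite (ge0_integral_transfer _ _ _ _ _ mu (mscale (NngNum w0) nu))//.
  rewrite ge0_integral_mscale//; last by move=> u _; rewrite lee_fin.
  exact/measurable_EFinP.
move=> B mB; apply: (etrans _ (law B mB)).
have mXB : measurable (X @^-1` B).
  by rewrite -[X in measurable X]setTI; exact: mX.
rewrite -[in RHS](setIT (_ `&` _)) -integral_indic//; last exact: measurableI.
apply: eq_integral => t _; congr EFin.
by rewrite setIC indicI.
Qed.

Lemma ge0_integral_bool_mixture (R : realType) (d d' : measure_display)
    (T : measurableType d) (U : measurableType d')
    (mu : {measure set T -> \bar R}) (nu1 nu0 : {measure set U -> \bar R})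
    (I : T -> bool) (X : T -> U) (w1 w0 : R) :
  measurable_fun setT I -> measurable_fun setT X -> 0 <= w1 -> 0 <= w0 ->
  (forall B, measurable B ->
     mu ([set t | I t] `&` X @^-1` B) = (w1%:E * nu1 B)%E /\
     mu ([set t | ~~ I t] `&` X @^-1` B) = (w0%:E * nu0 B)%E) ->
  forall f : bool -> U -> R, (forall b, measurable_fun setT (f b)) ->
  (forall b u, 0 <= f b u) ->
  (\int[mu]_t (f (I t) (X t))%:E =
   w1%:E * \int[nu1]_u (f true u)%:E + w0%:E * \int[nu0]_u (f false u)%:E)%E.
Proof.
move=> mI mX w10 w00 law f mf f0.
have mA1 : measurable [set t | I t].
  by rewrite -[X in measurable X]setTI; exact: (mI measurableT [set true]).
have mA0 : measurable [set t | ~~ I t].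
  rewrite (_ : mkset _ = ~` [set t | I t]); first exact: measurableC.
  by apply/seteqP; split => t /= /negP.
have mfX b A : measurable A ->
    measurable_fun setT (fun t => (f b (X t) * \1_A t)%:E).
  move=> mA; apply/measurable_EFinP/measurable_funM => //.
  exact: measurableT_comp (mf b) mX.
rewrite -(ge0_integral_restricted_law _ _ _ _ _ mu nu1 _ X w1 mA1)//; last first.
  by move=> B mB; have [] := law B mB.
rewrite -(ge0_integral_restricted_law _ _ _ _ _ mu nu0 _ X w0 mA0)//; last first.
  by move=> B mB; have [] := law B mB.
rewrite -ge0_integralD//.
- apply: eq_integral => t _; rewrite -EFinD; congr EFin; rewrite !indicE.
  have [It|It] := boolP (I t).
    by rewrite mem_set// memNset/= ?It// mulr1 mulr0 addr0.
  by rewrite memNset/= ?(negbTE It)// mem_set/= ?It// mulr1 mulr0 add0r.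
- by move=> t _; rewrite lee_fin mulr_ge0// indicE.
- exact: mfX.
- by move=> t _; rewrite lee_fin mulr_ge0// indicE.
- exact: mfX.
Qed.

(** * Moment bounds for the noise and the indicators *)

Section gaussian_mixture.
Variables (R : realType) (d : measure_display) (T : measurableType d).
Variables (P : probability T R) (I : T -> bool) (X : T -> R).
Variables (p m1 m0 sigma : R).
Hypothesis mI : measurable_fun setT I.
Hypothesis mX : measurable_fun setT X.
Hypothesis p01 : 0 <= p <= 1.
Hypothesis sigma0 : 0 < sigma.
Hypothesis law : forall A : set R, measurable A ->
  P ([set t | I t] `&` X @^-1` A) = (p%:E * normal_prob m1 sigma A)%E /\
  P ([set t | ~~ I t] `&` X @^-1` A) = ((1 - p)%:E * normal_prob m0 sigma A)%E.

Let p0 : 0 <= p. Proof. by case/andP: p01. Qed.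
Let q0 : 0 <= 1 - p. Proof. by rewrite subr_ge0; case/andP: p01. Qed.

(** Once the conditional mean is subtracted, both branches are centered Gaussians with the same
    variance, so the weights [p] and [1 - p] add up to 1. *)
Lemma noise_mgf (a s : R) :
  (\int[P]_t (expR (s * (a * (X t - if I t then m1 else m0))))%:E =
   (expR (s ^+ 2 * (a ^+ 2 * sigma ^+ 2) / 2))%:E)%E.
Proof.
rewrite (ge0_integral_bool_mixture _ _ _ _ _ P
  (normal_prob m1 sigma) (normal_prob m0 sigma) I X p (1 - p) mI mX p0 q0 law
  (fun b x => expR (s * (a * (x - if b then m1 else m0)))))//; last first.
  move=> b; apply: measurableT_comp => //; apply: measurable_funM => //.
  by apply: measurable_funM => //; exact: measurable_funB.
under eq_integral do rewrite mulrA.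
rewrite integral_normal_mgf//.
under eq_integral do rewrite mulrA.
rewrite integral_normal_mgf// -!EFinM -EFinD -mulrDl subrKC mul1r.
by congr (expR _)%:E; ring.
Qed.

(** The integrand ignores [X], so the Gaussian laws integrate to 1 and a Bernoulli average remains,
    bounded by Hoeffding's lemma at [s * a]. *)
Lemma indicator_mgf (a s : R) :
  (\int[P]_t (expR (s * (a * ((I t)%:R - p))))%:E <=
   (expR (s ^+ 2 * (a ^+ 2 / 4) / 2))%:E)%E.
Proof.
rewrite (ge0_integral_bool_mixture _ _ _ _ _ P
  (normal_prob m1 sigma) (normal_prob m0 sigma) I X p (1 - p) mI mX p0 q0 law
  (fun b x => expR (s * (a * (b%:R - p)))))//.
have N1 m : normal_prob m sigma [set: R] = 1%E.
  exact: (@probability_setT _ _ _ (normal_prob m sigma)).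
rewrite !integral_cst//= !N1 !mule1 -!EFinM -EFinD lee_fin.
have := @bernoulli_hoeffding R p (s * a) p01.
have -> : (s * a) ^+ 2 / 8 = s ^+ 2 * (a ^+ 2 / 4) / 2 by field.
apply: le_trans; rewrite le_eqVlt; apply/orP; left; apply/eqP.
by congr (_ * expR _ + _ * expR _); ring.
Qed.

End gaussian_mixture.

(** * Concentration of the threshold estimate *)

Theorem theorem1 (R : realType) (d : measure_display) (T : measurableType d)
  (P : probability T R) (mu1 mu2 sigma p q : R) (np nm : nat)
  (Ip : 'I_np -> T -> bool) (Xp : 'I_np -> T -> R)
  (Im : 'I_nm -> T -> bool) (Xm : 'I_nm -> T -> R) :
  mu2 < mu1 -> 0 < sigma -> 0 <= p <= 1 -> 0 <= q <= 1 ->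
  (0 < np)%N -> (0 < nm)%N ->
  (* measurability *)
  (forall i, measurable_fun setT (Ip i)) -> (forall i, measurable_fun setT (Xp i)) ->
  (forall j, measurable_fun setT (Im j)) -> (forall j, measurable_fun setT (Xm j)) ->
  (* Bernoulli indicators *)
  (forall i (A : set bool), P (Ip i @^-1` A) = bernoulli_prob p A) ->
  (forall j (A : set bool), P (Im j @^-1` A) = bernoulli_prob q A) ->
  (* mutual independence of the pairs *)
  mutually_independent P (all_pairs Ip Xp Im Xm) ->
  (* conditional laws, stated as joint laws of (I, X) *)
  (forall i (A : set R), measurable A ->
     P ([set t | Ip i t] `&` Xp i @^-1` A) = (p%:E * normal_prob mu1 sigma A)%E /\
     P ([set t | ~~ Ip i t] `&` Xp i @^-1` A) = ((1 - p)%:E * normal_prob mu2 sigma A)%E) ->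
  (forall j (A : set R), measurable A ->
     P ([set t | Im j t] `&` Xm j @^-1` A) = (q%:E * normal_prob mu2 sigma A)%E /\
     P ([set t | ~~ Im j t] `&` Xm j @^-1` A) = ((1 - q)%:E * normal_prob mu1 sigma A)%E) ->
  forall delta : R, 0 < delta ->
  let Delta := p - q in
  let theta_hat := fun t : T =>
    2^-1 * ((np%:R)^-1 * \sum_(i < np) Xp i t + (nm%:R)^-1 * \sum_(j < nm) Xm j t) in
  ((1 - 2 * expR (- (2 * delta ^+ 2 / (9 * sigma ^+ 2)) * (np%:R * nm%:R / (nm%:R + np%:R)))
       - 2 * expR (- (8 * np%:R * delta ^+ 2 / (9 * (mu1 - mu2) ^+ 2)))
       - 2 * expR (- (8 * nm%:R * delta ^+ 2 / (9 * (mu1 - mu2) ^+ 2))))%:E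
   <= P [set t | (`|theta_hat t - (mu1 + mu2) / 2 - Delta * (mu1 - mu2) / 2| <= delta)%R])%E.
Proof.
move=> mu21 sigma0 p01 q01 np0 nm0 mIp mXp mIm mXm _ _ indep lawp lawm.
move=> delta delta0 /=.
pose Z := all_pairs Ip Xp Im Xm.
have mZ k : measurable_fun setT (Z k).
  by case: k => i; apply/measurable_fun_prod.
(* For each observation: the probability [w] of a correct pseudo-label, and the means [m1] and [m0]
   given a correct and a wrong one. *)
pose w (k : 'I_np + 'I_nm) := if k is inl _ then p else q.
pose m1 (k : 'I_np + 'I_nm) := if k is inl _ then mu1 else mu2.
pose m0 (k : 'I_np + 'I_nm) := if k is inl _ then mu2 else mu1.
pose noise (a : 'I_np + 'I_nm -> R) k (u : bool * R) :=
  a k * (u.2 - if u.1 then m1 k else m0 k).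
pose flip (a : 'I_np + 'I_nm -> R) k (u : bool * R) := a k * (u.1%:R - w k).
have mnoise a k : measurable_fun setT (noise a k).
  apply: measurable_funM => //; apply: measurable_funB => //.
  exact: measurable_fun_ifT.
have mflip a k : measurable_fun setT (flip a k).
  apply: measurable_funM => //; apply: measurable_funB => //.
  have -> : (fun u : bool * R => u.1%:R : R) = (fun u => if u.1 then 1 else 0).
    by apply/funext => -[[]].
  exact: measurable_fun_ifT.
have noise_mgfP a k s : (\int[P]_t (expR (s * noise a k (Z k t)))%:E <=
    (expR (s ^+ 2 * (a k ^+ 2 * sigma ^+ 2) / 2))%:E)%E.
  rewrite le_eqVlt; apply/orP; left; apply/eqP; case: k => i.
    exact: (noise_mgf _ _ _ _ _ _ _ _ _ _ (mIp i) (mXp i) p01 sigma0 (lawp i)).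
  exact: (noise_mgf _ _ _ _ _ _ _ _ _ _ (mIm i) (mXm i) q01 sigma0 (lawm i)).
have flip_mgfP a k s : (\int[P]_t (expR (s * flip a k (Z k t)))%:E <=
    (expR (s ^+ 2 * (a k ^+ 2 / 4) / 2))%:E)%E.
  case: k => i.
    exact: (indicator_mgf _ _ _ _ _ _ _ _ _ _ (mIp i) (mXp i) p01 (lawp i)).
  exact: (indicator_mgf _ _ _ _ _ _ _ _ _ _ (mIm i) (mXm i) q01 (lawm i)).
pose n : R := np%:R; pose m : R := nm%:R.
have n_gt0 : 0 < n by rewrite ltr0n.
have m_gt0 : 0 < m by rewrite ltr0n.
have nn0 : n != 0 by rewrite gt_eqF.
have mn0 : m != 0 by rewrite gt_eqF.
have D0 : 0 < mu1 - mu2 by rewrite subr_gt0.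
have Dn0 : mu1 - mu2 != 0 by rewrite gt_eqF.
have sn0 : sigma != 0 by rewrite gt_eqF.
(* The conditional means are [mu2 + (mu1 - mu2) * I] for positive and [mu1 - (mu1 - mu2) * I] for
   negative pseudo-labels, hence the minus sign in [aM]. The zeros in [aP] and [aM] let all three
   sums run over the one independent family [Z]. *)
pose aN (k : 'I_np + 'I_nm) := if k is inl _ then (2 * n)^-1 else (2 * m)^-1.
pose aP (k : 'I_np + 'I_nm) :=
  if k is inl _ then (mu1 - mu2) / (2 * n) else 0.
pose aM (k : 'I_np + 'I_nm) :=
  if k is inl _ then 0 else - ((mu1 - mu2) / (2 * m)).
have sumE (f : 'I_np + 'I_nm -> R) (x y : R) : (forall i, f (inl i) = x) ->
    (forall j, f (inr j) = y) -> \sum_k f k = x * n + y * m.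
  move=> fx fy; rewrite big_sumType/=.
  congr (_ + _); [rewrite (eq_bigr (fun=> x))//|rewrite (eq_bigr (fun=> y))//];
    by rewrite sumr_const card_ord /n /m mulr_natr.
have eps0 : 0 < delta / 3 by rewrite divr_gt0.
have VN : \sum_k aN k ^+ 2 * sigma ^+ 2 = sigma ^+ 2 * (n + m) / (4 * n * m).
  rewrite (sumE _ ((2 * n)^-1 ^+ 2 * sigma ^+ 2) ((2 * m)^-1 ^+ 2 * sigma ^+ 2))//.
  by field; rewrite nn0 mn0.
have VP : \sum_k aP k ^+ 2 / 4 = (mu1 - mu2) ^+ 2 / (16 * n).
  rewrite (sumE _ (((mu1 - mu2) / (2 * n)) ^+ 2 / 4) 0)//.
    by field.
  by move=> j; rewrite /aP expr0n mul0r.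
have VM : \sum_k aM k ^+ 2 / 4 = (mu1 - mu2) ^+ 2 / (16 * m).
  rewrite (sumE _ 0 (((mu1 - mu2) / (2 * m)) ^+ 2 / 4))//.
  - by field.
  - by move=> j; rewrite /aM expr0n mul0r.
  - by move=> j; rewrite /aM sqrrN.
have VN0 : 0 < \sum_k aN k ^+ 2 * sigma ^+ 2.
  by rewrite VN divr_gt0 ?mulr_gt0 ?exprn_gt0 ?addr_gt0.
have VP0 : 0 < \sum_k aP k ^+ 2 / 4.
  by rewrite VP divr_gt0 ?mulr_gt0 ?exprn_gt0.
have VM0 : 0 < \sum_k aM k ^+ 2 / 4.
  by rewrite VM divr_gt0 ?mulr_gt0 ?exprn_gt0.
have tailN := subgaussian_sum_tail _ _ _ _ _ P _ Z mZ indep _ _ _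
  (mnoise aN) (noise_mgfP aN) VN0 eps0.
have tailP := subgaussian_sum_tail _ _ _ _ _ P _ Z mZ indep _ _ _
  (mflip aP) (flip_mgfP aP) VP0 eps0.
have tailM := subgaussian_sum_tail _ _ _ _ _ P _ Z mZ indep _ _ _
  (mflip aM) (flip_mgfP aM) VM0 eps0.
move: tailN tailP tailM; rewrite VN VP VM.
set SN := fun t => \sum_k noise aN k (Z k t).
set SP := fun t => \sum_k flip aP k (Z k t).
set SM := fun t => \sum_k flip aM k (Z k t).
(* With threshold [delta / 3], the three variance proxies yield exactly the stated exponents. *)
have -> : (delta / 3) ^+ 2 / (2 * (sigma ^+ 2 * (n + m) / (4 * n * m))) =
    2 * delta ^+ 2 / (9 * sigma ^+ 2) * (n * m / (m + n)).
  by field; rewrite nn0 mn0 sn0 gt_eqF ?addr_gt0.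
have -> : (delta / 3) ^+ 2 / (2 * ((mu1 - mu2) ^+ 2 / (16 * n))) =
    8 * n * delta ^+ 2 / (9 * (mu1 - mu2) ^+ 2).
  by field; rewrite nn0 Dn0.
have -> : (delta / 3) ^+ 2 / (2 * ((mu1 - mu2) ^+ 2 / (16 * m))) =
    8 * m * delta ^+ 2 / (9 * (mu1 - mu2) ^+ 2).
  by field; rewrite mn0 Dn0.
move=> tailN tailP tailM.
pose theta t := 2^-1 * (np%:R^-1 * \sum_(i < np) Xp i t +
  nm%:R^-1 * \sum_(j < nm) Xm j t) - (mu1 + mu2) / 2 - (p - q) * (mu1 - mu2) / 2.
(* The centering is the half-sum of the means [mu2 + (mu1 - mu2) * p] and [mu1 - (mu1 - mu2) * q] of
   the two groups. *)
have thetaE t : theta t = SN t + SP t + SM t.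
  pose xp := \sum_i Xp i t; pose xm := \sum_j Xm j t.
  pose ip : R := \sum_i (Ip i t)%:R; pose im : R := \sum_j (Im j t)%:R.
  have SNE : SN t = (2 * n)^-1 * (xp - (mu2 * n + (mu1 - mu2) * ip)) +
      (2 * m)^-1 * (xm - (mu1 * m - (mu1 - mu2) * im)).
    rewrite /SN big_sumType/= /noise/= -!mulr_sumr !sumrB.
    congr (_ * (_ - _) + _ * (_ - _)).
      rewrite (eq_bigr (fun i => mu2 + (mu1 - mu2) * (Ip i t)%:R)); last first.
        by move=> i _; case: (Ip i t) => /=; ring.
      by rewrite big_split/= sumr_const card_ord -mulr_sumr /n /m mulr_natr.
    rewrite (eq_bigr (fun i => mu1 - (mu1 - mu2) * (Im i t)%:R)); last first.
      by move=> i _; case: (Im i t) => /=; ring.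
    by rewrite sumrB sumr_const card_ord -mulr_sumr /n /m mulr_natr.
  have SPE : SP t = (mu1 - mu2) / (2 * n) * (ip - p * n).
    rewrite /SP big_sumType/= /flip/= -!mulr_sumr !sumrB mul0r addr0.
    by rewrite sumr_const card_ord -[p *+ _]mulr_natr.
  have SME : SM t = - ((mu1 - mu2) / (2 * m)) * (im - q * m).
    rewrite /SM big_sumType/= /flip/= -!mulr_sumr !sumrB mul0r add0r.
    by rewrite sumr_const card_ord -[q *+ _]mulr_natr.
  rewrite SNE SPE SME /theta -/xp -/xm -/n -/m.
  by field; rewrite nn0 mn0.
have mSum (g : 'I_np + 'I_nm -> bool * R -> R) :
    (forall k, measurable_fun setT (g k)) ->
    measurable_fun setT (fun t => \sum_k g k (Z k t)).
  by move=> mg; apply: measurable_sum => k; exact: measurableT_comp (mg k) (mZ k).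
set E := [set t | _]; set bN := [set t | _] in tailN.
set bP := [set t | _] in tailP; set bM := [set t | _] in tailM.
have mbN : measurable bN.
  by apply: measurable_superlevel; apply: measurableT_comp => //; exact: mSum.
have mbP : measurable bP.
  by apply: measurable_superlevel; apply: measurableT_comp => //; exact: mSum.
have mbM : measurable bM.
  by apply: measurable_superlevel; apply: measurableT_comp => //; exact: mSum.
have mtheta : measurable_fun setT theta.
  rewrite (funext thetaE); apply: measurable_funD; last exact: mSum.
  by apply: measurable_funD; exact: mSum.
have mE : measurable E.
  rewrite (_ : E = [set t | - delta <= - `|theta t|]).
    apply: measurable_superlevel; apply: measurableT_comp => //.
    exact: measurableT_comp.
  by apply/seteqP; split => t /=; rewrite lerN2.
(* If all three terms are below [delta / 3] in absolute value, the triangle inequality puts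
   [theta t] below [delta]. *)
have EC : ~` E `<=` bN `|` (bP `|` bM).
  move=> t /= /negP; rewrite -ltNge -/(theta t) thetaE => dlt.
  have [hN|hN] := leP (delta / 3) `|SN t|; first by left.
  have [hP|hP] := leP (delta / 3) `|SP t|; first by right; left.
  have [hM|hM] := leP (delta / 3) `|SM t|; first by right; right.
  have h1 := ler_normD (SN t + SP t) (SM t).
  have h2 := ler_normD (SN t) (SP t).
  by exfalso; lra.
have PEC : (P (~` E) <= P bN + (P bP + P bM))%E.
  apply: (@le_trans _ _ (P (bN `|` (bP `|` bM)))).
    apply: le_measure => //; rewrite inE; first exact: measurableC.
    by apply: measurableU => //; exact: measurableU.
  apply: le_trans (measureU2 _ _ _) _ => //; first exact: measurableU.
  by rewrite leeD2l// measureU2.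
rewrite -[X in P X]setCK probability_setC; last exact: measurableC.
move/(le_trans PEC): (leeD tailN (leeD tailP tailM)).
rewrite -!EFinD -/n -/m => PEC'.
have : P (~` E) \is a fin_num by apply: fin_num_measure; exact: measurableC.
move=> /fineK PEE; move: PEC'; rewrite -PEE -EFinB !lee_fin mulNr.
by move=> ?; lra.
Qed.
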